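(* Let $d\ge 2$ and let $\mathcal{X}^n=\{X_1,\dots,X_n\}\subset\mathbb{R}^d$ be a data set in general position, with empirical measure $P_n$. Let $\mathbf{PD}(\cdot,P_n)$, $x_{0,P}$, $\ell$ and $h_P$ be as defined in the context, and let $$\tau_*=\inf\{\mathbf{PD}(x,P_n): x\in\mathbb{R}^d,\ \|x-x_{0,P}\|=\ell\}.$$ Then for any $0<\tau_1<\tau_2<\tau_*$, the sample projection depth contours with depth values $\tau_1$ and $\tau_2$ are similar to each other, with similarity center the projection depth median $x_{0,P}$ and generating function $h_P(\cdot,\cdot)$. That is, for every $u\in\mathcal{S}^{d-1}$, if $x_{0,P}+\lambda_x u$ and $x_{0,P}+\lambda_y u$ (with $\lambda_x,\lambda_y>0$) denote the intersection points of the ray from $x_{0,P}$ in direction $u$ with the $\tau_1$-contour and the $\tau_2$-contour respectively, then $$\tau_1=h_P(\lambda_x,u),\qquad \tau_2=h_P(\lambda_y,u).$$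
   Context: General position: no more than $d$ of the data points lie in any $(d-1)$-dimensional hyperplane. Let $\mathcal{S}^{d-1}=\{u\in\mathbb{R}^d:\|u\|=1\}$ and $u^\top\mathcal{X}^n=\{u^\top X_1,\dots,u^\top X_n\}$. For univariate data $\mathcal{Z}^n=\{Z_1,\dots,Z_n\}$ with order statistics $Z_{(1)}\le\dots\le Z_{(n)}$, $\mathrm{Med}(\mathcal{Z}^n)=\tfrac12\big(Z_{(\lfloor (n+1)/2\rfloor)}+Z_{(\lfloor (n+2)/2\rfloor)}\big)$ and $\mathrm{MAD}(\mathcal{Z}^n)=\mathrm{Med}\{|Z_i-\mathrm{Med}(\mathcal{Z}^n)|: i=1,\dots,n\}$. It is part of the standing setting that $\mathrm{MAD}(u^\top\mathcal{X}^n)>0$ for all $u\in\mathcal{S}^{d-1}$. Outlyingness and projection depth: $$O(x,P_n)=\sup_{u\in\mathcal{S}^{d-1}}\frac{|u^\top x-\mathrm{Med}(u^\top\mathcal{X}^n)|}{\mathrm{MAD}(u^\top\mathcal{X}^n)},\qquad \mathbf{PD}(x,P_n)=\frac{1}{1+O(x,P_n)}.$$ The projection depth median $x_{0,P}$ is the (known to be unique) maximizer of $\mathbf{PD}(\cdot,P_n)$. The $\tau$-th projection depth contour is the boundary of $\{x\in\mathbb{R}^d:\mathbf{PD}(x,P_n)\ge\tau\}$. Similarity: two depth contours $\mathcal{C}_1,\mathcal{C}_2$ with depth values $d_1,d_2$ are similar if there are a point $x_0\in\mathbb{R}^d$ (similarity center) and a function $h(\cdot,\cdot)$ (generating function), both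 determined by the data set, such that for every $u\in\mathcal{S}^{d-1}$, $d_1=h(\lambda_x,u)$ and $d_2=h(\lambda_y,u)$, where $x_0+\lambda_x u$ and $x_0+\lambda_y u$, $\lambda_x,\lambda_y>0$, are the intersection points of $\mathcal{C}_1$ and $\mathcal{C}_2$ with the ray from $x_0$ in direction $u$. It is known (and may be taken as given) that there are finitely many data-dependent direction vectors $u_1,\dots,u_N$ and data-dependent vectors $c_1,\dots,c_N,d_1,\dots,d_N\in\mathbb{R}^d$ with $u_k^\top d_k\neq0$ such that for all $x\in\mathbb{R}^d$ $$O(x,P_n)=\max_{1\le k\le N}\frac{u_k^\top x-u_k^\top c_k}{u_k^\top d_k}.$$ Fix these and put $$a_k=\frac{u_k^\top x_{0,P}-u_k^\top c_k}{u_k^\top d_k},\qquad b_k(v)=\frac{u_k^\top v}{u_k^\top d_k},\qquad \mathcal{C}_k=\Big\{t\in\mathbb{R}^d:\frac{u_k^\top t}{u_k^\top d_k}\ge\frac{u_l^\top t}{u_l^\top d_l}\ \ \forall\, l\ne k\Big\}.$$ For $v\in\mathcal{C}_{k_*}\cap\mathcal{S}^{d-1}$ (equivalently, $b_{k_*}(v)=\max_k b_k(v)$) put $$\lambda_{k_*}(v)=\inf\{\lambda: a_{k_*}+\lambda b_{k_*}(v)\ge a_k+\lambda b_k(v)\ \ \forall\, k\neq k_*\},$$ $$\gamma_{k_*}=\sup_{v\in\mathcal{C}_{k_*}\cap\mathcal{S}^{d-1}}\lambda_{k_*}(v),\qquad \ell=\max_{1\le k_*\le N,\ \mathcal{C}_{k_*}\text{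 nonempty}}\gamma_{k_*},$$ where $\ell$ is regarded as a finite number. The generating function is $$h_P(\lambda,v)=\sum_{k_*:\,v\in\mathcal{C}_{k_*}}\frac{1}{1+a_{k_*}+\lambda\, b_{k_*}(v)},$$ where the sum selects the cone containing $v$ (each direction $v$ being regarded as belonging to one and only one cone, so that the sum has a single term). *)

(* Defs.v *)
(* Points of R^d are column vectors. *)
From mathcomp Require Export all_boot all_order all_algebra.
From mathcomp Require Export all_classical all_reals all_analysis.
Export Order.TTheory GRing.Theory Num.Theory.
Export numFieldNormedType.Exports.

Set Implicit Arguments.
Unset Strict Implicit.
Unset Printing Implicit Defensive.

Local Open Scope classical_set_scope.
Local Open Scope ring_scope.

Section Euclidean.
Context {R : realType} {d : nat}.
Implicit Types u v x : 'cV[R]_d.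

Definition dot u v : R := (u^T *m v) 0 0.

(* The library norm on matrices is the max norm, hence this definition; both
   norms induce the same topology. *)
Definition norm2 u : R := Num.sqrt (dot u u).

Definition unit_sphere : set 'cV[R]_d := [set u | norm2 u = 1].

Definition boundary (A : set 'cV[R]_d) : set 'cV[R]_d :=
  closure A `\` interior A.

End Euclidean.

Section Univariate.
Context {R : realType} {n : nat}.
Implicit Type Z : 'I_n -> R.

(* [order_stat Z i] is Z_(i), with i counted from 1 to n. *)
Definition order_stat Z (i : nat) : R := nth 0 (sort <=%R (codom Z)) i.-1.

Definition Med Z : R :=
  (order_stat Z ((n + 1) %/ 2) + order_stat Z ((n + 2) %/ 2)) / 2.

Definition MAD Z : R := Med (fun i => `|Z i - Med Z|).

End Univariate.

Section ProjectionDepth.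
Context {R : realType} {d n : nat}.
Variable X : 'I_n -> 'cV[R]_d.
Implicit Types u v x : 'cV[R]_d.

(* Data points are counted by index, i.e. with multiplicity. *)
Definition general_position : Prop :=
  forall v (c : R), v != 0 -> (#|[pred i : 'I_n | dot v (X i) == c]| <= d)%N.

Definition proj u : 'I_n -> R := fun i => dot u (X i).

(* The set is bounded above as soon as [MAD (proj u) > 0] on the unit sphere,
   by compactness. *)
Definition outlyingness x : R :=
  sup [set `|dot u x - Med (proj u)| / MAD (proj u) | u in unit_sphere].

Definition PD x : R := 1 / (1 + outlyingness x).

(* The maximizer is in fact unique; uniqueness is not assumed. *)
Definition is_PD_median x : Prop := forall y, PD y <= PD x.

Definition PD_contour (tau : R) : set 'cV[R]_d := boundary [set x | tau <= PD x].

End ProjectionDepth.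

(* Contours [C1] and [C2], of depths [d1] and [d2], are similar with similarity
   center [x0] and generating function [h]. *)
Definition similar_contours {R : realType} {d : nat}
    (x0 : 'cV[R]_d) (h : R -> 'cV[R]_d -> R)
    (C1 : set 'cV[R]_d) (d1 : R) (C2 : set 'cV[R]_d) (d2 : R) : Prop :=
  forall u, unit_sphere u ->
  forall lx ly : R, 0 < lx -> 0 < ly ->
    C1 (x0 + lx *: u) -> C2 (x0 + ly *: u) ->
    d1 = h lx u /\ d2 = h ly u.

Section Representation.
Context {R : realType} {d N : nat}.
Variables (U C D : 'I_N -> 'cV[R]_d) (x0 : 'cV[R]_d).
Implicit Types (v t : 'cV[R]_d) (k l ks : 'I_N).

(* The maximum is taken in \bar R, where the empty maximum is -oo, so the
   identity forces N > 0. *)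
Definition max_representation (O : 'cV[R]_d -> R) : Prop :=
  (forall k, dot (U k) (D k) != 0) /\
  forall x, (O x)%:E =
    \big[maxe/-oo%E]_(k < N)
      ((dot (U k) x - dot (U k) (C k)) / dot (U k) (D k))%:E.

Definition acoef k : R := (dot (U k) x0 - dot (U k) (C k)) / dot (U k) (D k).

Definition bcoef k v : R := dot (U k) v / dot (U k) (D k).

Definition cone k : set 'cV[R]_d :=
  [set t | forall l, l != k -> bcoef l t <= bcoef k t].

(* Infima, suprema and maxima are extended reals, so that the finiteness of
   [ell] is a genuine condition: inf set0 = +oo and sup set0 = -oo. *)
Definition lambda_ ks v : \bar R :=
  ereal_inf [set l%:E | l in [set l : R | forall k, k != ks ->
    acoef k + l * bcoef k v <= acoef ks + l * bcoef ks v]].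

Definition gamma_ ks : \bar R :=
  ereal_sup [set lambda_ ks v | v in cone ks `&` unit_sphere].

Definition ell : \bar R :=
  \big[maxe/-oo%E]_(ks < N | `[< cone ks !=set0 >]) gamma_ ks.

(* The closed cones overlap; [kappa] attributes each direction to exactly one
   of the cones that contain it. *)
Definition cone_choice (kappa : 'cV[R]_d -> 'I_N) : Prop :=
  forall v, unit_sphere v -> cone (kappa v) v.

Definition h_P (kappa : 'cV[R]_d -> 'I_N) (l : R) v : R :=
  \sum_(k < N | kappa v == k) 1 / (1 + acoef k + l * bcoef k v).

End Representation.

Definition tau_star {R : realType} {d n : nat} (X : 'I_n -> 'cV[R]_d)
    (x0 : 'cV[R]_d) (r : R) : R :=
  inf [set PD X x | x in [set x | norm2 (x - x0) = r]].

(* Main.v *)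
(* Along a ray from the projection depth median x0, the outlyingness O is
   convex with a minimum at x0, hence nondecreasing. A point of a contour of
   depth below tau_star is therefore farther than ell from x0. Beyond ell the
   affine piece of O attached to the cone of the direction, whose slope is
   maximal, dominates all the others, so that it equals O. *)
Require Import Defs.
From mathcomp Require Import ring lra.

Local Open Scope classical_set_scope.
Local Open Scope ring_scope.

Section Dot.
Context {R : realType} {d : nat}.
Implicit Types u v x : 'cV[R]_d.

Lemma dotE u v : dot u v = \sum_(j < d) u j 0 * v j 0.
Proof. by rewrite /dot mxE; apply: eq_bigr => j _; rewrite mxE. Qed.

Lemma dotDr u v x : dot u (v + x) = dot u v + dot u x.
Proof. by rewrite /dot mulmxDr mxE. Qed.

Lemma dotZr u (l : R) x : dot u (l *: x) = l * dot u x.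
Proof. by rewrite /dot -scalemxAr mxE. Qed.

Lemma dot_continuous u : continuous (dot u).
Proof.
rewrite (_ : dot u = fun v => \sum_(j < d) u j 0 * v j 0); last first.
  by apply/funext => v; exact: dotE.
apply: continuous_big => [|j _ x]; first exact: add_continuous.
apply: (@continuousM _ _ (fun=> u j 0) (fun v => v j 0)).
  exact: cst_continuous.
exact: coord_continuous.
Qed.

Lemma norm2Z (l : R) u : norm2 (l *: u) = `|l| * norm2 u.
Proof.
have -> : norm2 (l *: u) = Num.sqrt (l ^+ 2 * dot u u).
  by congr Num.sqrt; rewrite !dotE mulr_sumr; apply: eq_bigr => j _;
     rewrite !mxE; ring.
by rewrite sqrtrM ?sqr_ge0// sqrtr_sqr.
Qed.

End Dot.

Section Depth.
Context {R : realType} {d n : nat} (X : 'I_n -> 'cV[R]_d).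
Hypothesis hMAD : forall u : 'cV[R]_d, unit_sphere u -> 0 < MAD (proj X u).

Lemma outlyingness_ge0 x : 0 <= outlyingness X x.
Proof.
rewrite /outlyingness; set S := [set _ | _ in _].
(* Without a supremum, [sup S] takes its default value 0; otherwise it bounds some element of [S], a
   nonnegative ratio. *)
have [hS|/sup_out -> //] := pselect (has_sup S).
have [[y Sy] _] := hS.
apply: (@le_trans _ _ y); last by apply: sup_upper_bound.
by case: Sy => u hu <-; rewrite divr_ge0// ltW// hMAD.
Qed.

Lemma PD_gt0 x : 0 < PD X x.
Proof. by rewrite /PD divr_gt0// ltr_wpDr// outlyingness_ge0. Qed.

Lemma le_PD x y : (PD X x <= PD X y) = (outlyingness X y <= outlyingness X x).
Proof.
have hx := outlyingness_ge0 x; have hy := outlyingness_ge0 y.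
by rewrite /PD !div1r lef_pV2 ?posrE ?lerD2l// ltr_wpDr.
Qed.

(** Turns the depth regions into sublevel sets of the outlyingness, to which the maximum formula
    applies. *)
Lemma PD_ge tau x : 0 < tau ->
  (tau <= PD X x) = (outlyingness X x <= tau^-1 - 1).
Proof.
move=> t0; have hx := outlyingness_ge0 x.
by rewrite /PD div1r -[leLHS]invrK lef_pV2 ?posrE ?invr_gt0 ?ltr_wpDr// lerBrDl.
Qed.

Lemma tau_star_le (x0 x : 'cV[R]_d) :
  tau_star X x0 (norm2 (x - x0)) <= PD X x.
Proof.
apply: ge_inf; last by exists x.
(* Depths are bounded below by 0, so [inf] is a genuine lower bound. *)
by exists 0 => _ [y _ <-]; apply/ltW/PD_gt0.
Qed.

End Depth.

Section MaxAffine.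
Context {R : realType} {d N : nat} {U C D : 'I_N -> 'cV[R]_d}.
Context {O : 'cV[R]_d -> R}.
Hypothesis hO : max_representation U C D O.
Implicit Types x v : 'cV[R]_d.

Local Notation a := (acoef U C D).
Local Notation b := (bcoef U D).

(** With its base point left free, [a x k] is the value at [x] of the [k]-th affine piece of [O].
    Upper bounds on [O] are thus checked piece by piece. *)
Lemma max_representation_leP x c :
  reflect (forall k, a x k <= c) (O x <= c).
Proof.
rewrite -lee_fin (hO.2 x); apply: (iffP idP) => [/bigmax_leP[_ h] k|h].
  by rewrite -lee_fin; exact: h.
by apply/bigmax_leP; split=> [|k _]; rewrite ?leNye// lee_fin; exact: h.
Qed.

Lemma acoef_ray x v l k : a (x + l *: v) k = a x k + l * b k v.
Proof. by rewrite /acoef /bcoef dotDr dotZr; ring. Qed.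

Lemma acoef_continuous k : continuous (a ^~ k).
Proof.
move=> x; apply: (@continuousM _ _ (fun y => dot (U k) y - dot (U k) (C k))).
  by apply: continuousB; [exact: dot_continuous|exact: cst_continuous].
exact: cst_continuous.
Qed.

(** A piece above [c] at [x] stays above [c] nearby, which keeps [x] out of the closure. If all
    pieces are below [c] at [x], then, being finitely many, they stay so on a common neighbourhood,
    and [x] is interior. *)
Lemma boundary_sublevel c x : boundary [set y | O y <= c] x -> O x = c.
Proof.
case=> clx nix; apply/eqP; rewrite eq_le; apply/andP; split.
  apply/max_representation_leP => k; rewrite leNgt; apply/negP => ck.
  have nk : nbhs x [set y | c < a y k].
    exact: (@acoef_continuous k x _ (lt_nbhsr ck)).
  have [y /= [/max_representation_leP/(_ k) yc cy]] := clx _ nk.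
  by rewrite ltNge yc in cy.
rewrite leNgt; apply/negP => xc; apply: nix.
have : \forall y \near x, forall k, a y k < c.
  apply: (@filter_forall _ _ _ (nbhs x) (nbhs_filter x)) => k.
  apply: (@acoef_continuous k x [set z | z < c]); apply: lt_nbhsl.
  (* Generalized over the piece, the goal is equivalent to [O x <= O x]. *)
  by apply: le_lt_trans xc; move: k; exact/max_representation_leP.
by apply: filterS => y yc; apply/max_representation_leP => k; exact/ltW.
Qed.

(** Along the ray, a piece of nonnegative slope is bounded by its value at [m]; a piece of negative
    slope is bounded by its value at [x0], hence by [O x0], and minimality concludes. *)
Lemma le_ray_of_min x0 v l m : (forall x, O x0 <= O x) -> 0 <= l <= m ->
  O (x0 + l *: v) <= O (x0 + m *: v).
Proof.
move=> hmin /andP[l0 lm]; apply/max_representation_leP => k.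
have := elimT (max_representation_leP _ _) (lexx (O (x0 + m *: v))) k.
have := elimT (max_representation_leP _ _) (hmin (x0 + m *: v)) k.
rewrite !acoef_ray; have [b0|/ltW b0] := leP 0 (b k v) => h1 h2.
  by apply: le_trans h2; rewrite lerD2l ler_wpM2r.
by apply: le_trans h1; rewrite gerDl mulr_ge0_le0.
Qed.

Lemma lambda_le_ell x0 k v : unit_sphere v -> cone U D k v ->
  (lambda_ U C D x0 k v <= ell U C D x0)%E.
Proof.
move=> hv hk; apply: (@le_trans _ _ (gamma_ U C D x0 k)).
  by apply: ereal_sup_ubound; exists v.
(* The direction [v] itself shows that the cone is nonempty, so its [gamma_] enters the maximum. *)
by apply: le_bigmax_cond; apply/asboolP; exists v.
Qed.

Lemma max_beyond_lambda x0 k v l : cone U D k v ->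
  (lambda_ U C D x0 k v < l%:E)%E -> O (x0 + l *: v) = a x0 k + l * b k v.
Proof.
(* The strict inequality yields a real [m < l] at which piece [k] already dominates, even if the
   infimum is -oo. *)
move=> hk /ereal_inf_lt[_ [m hm <-]]; rewrite lte_fin => ml.
apply/eqP; rewrite eq_le; apply/andP; split.
  apply/max_representation_leP => j; rewrite acoef_ray.
  have [->//|jk] := eqVneq j k.
  (* From [m] to [l], piece [k] gains [(l - m) * (b k v - b j v) >= 0] over piece [j]. *)
  have := hm _ jk; have := hk _ jk => h1 h2; nra.
rewrite -acoef_ray; move: k {hk hm}; exact/max_representation_leP.
Qed.

End MaxAffine.

Lemma PD_contour_h_P (R : realType) (d n : nat) (X : 'I_n -> 'cV[R]_d)
  (hMAD : forall u : 'cV[R]_d, unit_sphere u -> 0 < MAD (proj X u))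
  (x0 : 'cV[R]_d) (hx0 : is_PD_median X x0)
  (N : nat) (U C D : 'I_N -> 'cV[R]_d)
  (hO : max_representation U C D (outlyingness X))
  (kappa : 'cV[R]_d -> 'I_N) (hkappa : cone_choice U D kappa)
  (hell : ell U C D x0 \is a fin_num) (tau : R) (htau0 : 0 < tau)
  (htau : tau < tau_star X x0 (fine (ell U C D x0)))
  (u : 'cV[R]_d) (hu : unit_sphere u) (l : R) (hl : 0 < l) :
  PD_contour X tau (x0 + l *: u) -> tau = h_P U C D x0 kappa l u.
Proof.
have hmin x : outlyingness X x0 <= outlyingness X x.
  by rewrite -le_PD//; exact: hx0.
rewrite /PD_contour (_ : [set x | _] =
  [set x | outlyingness X x <= tau^-1 - 1]); last first.
  by apply/funext => x /=; rewrite PD_ge.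
move=> /(boundary_sublevel hO) Ox.
have PDx : PD X (x0 + l *: u) = tau.
  by rewrite /PD Ox addrC subrK div1r invrK.
set e := fine (ell U C D x0) in htau.
(* Otherwise the point at distance [e] on the ray has depth at least [tau_star], hence above [tau],
   while the nearer contour point, of depth [tau], is at least as deep. *)
have el : e < l.
  rewrite ltNge; apply/negP => le_l_e.
  (* The sign of [e] comes from [0 < l <= e]; it makes [e] a distance. *)
  have e0 : 0 <= e by rewrite (le_trans (ltW hl)).
  have he : norm2 (x0 + e *: u - x0) = e.
    by rewrite addrAC subrr add0r norm2Z hu mulr1 ger0_norm.
  have := tau_star_le X hMAD x0 (x0 + e *: u); rewrite he.
  move=> /(lt_le_trans htau); rewrite -PDx ltNge => /negP; apply.
  by rewrite le_PD//; apply: (le_ray_of_min hO) => //; rewrite ltW.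
have lam : (lambda_ U C D x0 (kappa u) u < l%:E)%E.
  apply: (@le_lt_trans _ _ (ell U C D x0)).
    by apply: lambda_le_ell => //; exact: hkappa.
  by rewrite -(fineK hell) lte_fin.
rewrite /h_P (big_pred1 (kappa u)) => [|k]; last by rewrite eq_sym.
rewrite -PDx /PD.
by rewrite (max_beyond_lambda hO _ _ _ _ (hkappa _ hu) lam) addrA.
Qed.

Theorem theorem2 (R : realType) (d n : nat) (hd : (2 <= d)%N)
  (X : 'I_n -> 'cV[R]_d) (hX : general_position X)
  (hMAD : forall u : 'cV[R]_d, unit_sphere u -> 0 < MAD (proj X u))
  (x0 : 'cV[R]_d) (hx0 : is_PD_median X x0)
  (N : nat) (U C D : 'I_N -> 'cV[R]_d)
  (hO : max_representation U C D (outlyingness X))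
  (kappa : 'cV[R]_d -> 'I_N) (hkappa : cone_choice U D kappa)
  (hell : ell U C D x0 \is a fin_num)
  (tau1 tau2 : R) (htau1 : 0 < tau1) (htau12 : tau1 < tau2)
  (htau2 : tau2 < tau_star X x0 (fine (ell U C D x0))) :
  similar_contours x0 (h_P U C D x0 kappa)
    (PD_contour X tau1) tau1 (PD_contour X tau2) tau2.
Proof.
move=> u hu lx ly lx0 ly0 cx cy; split.
  by apply: PD_contour_h_P cx => //; exact: lt_trans htau2.
by apply: PD_contour_h_P cy => //; exact: lt_trans htau12.
Qed.
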